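(* For every positive integer $n$ and for every convex body $C\subset\mathbb{R}^n$ there is a $\delta>1$ such that the following holds: if $K$ is a convex body in $\mathbb{R}^n$ and $d(K,L)<\delta$ for some $L\in\mathcal{D}(C)$ (respectively, some $L\in\tilde{\mathcal{D}}(C)$), then $i(K)\le i(\mathcal{D}(C))$ (respectively, $i(K)\le i(\tilde{\mathcal{D}}(C))$).
   Context: A convex body is a compact convex set with non-empty interior. For a convex body $C\subset\mathbb{R}^n$ and a nonempty $X\subseteq\mathbb{R}^n$, let $\mathbf{B}_C^+(X)=\bigcap_{v\in X}(C+v)$, and let $\mathbf{B}_C^+(\emptyset)=\mathbb{R}^n$. Define $\mathcal{D}(C)=\{K\subset\mathbb{R}^n: K=\mathbf{B}_C^+(K)\}$ and $\tilde{\mathcal{D}}(C)=\{K\subset\mathbb{R}^n: K=\mathbf{B}_C^+(X)\text{ for some nonempty }X\subset\mathbb{R}^n\text{ with }X\subseteq\mathbf{B}_C^+(X)\}$; the members of both families are convex bodies. The covering number $i(K)$ of a convex body $K$ is the minimum number of positive homothetic copies of $K$, each with homothety ratio less than one, that cover $K$. For a family $\mathcal{F}$ of convex bodies, $i(\mathcal{F})=\max\{i(K):K\in\mathcal{F}\}$. The Banach--Mazur distance of convex bodies $K,L\subset\mathbb{R}^n$ is $d(K,L)=\inf\{\lambda>0: K\subset T(L)\subset\lambda K+v\}$, where the infimum is taken over all non-singular affine transformations $T$ of $\mathbb{R}^n$ and all $v\in\mathbb{R}^n$. *)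

(* Defs.v *)
From HB Require Import structures.
From mathcomp Require Import all_boot all_order all_algebra.
From mathcomp Require Import all_classical all_reals all_analysis.

Set Implicit Arguments.
Unset Strict Implicit.
Unset Printing Implicit Defensive.

Import Order.TTheory GRing.Theory Num.Theory.
Import numFieldNormedType.Exports.

Local Open Scope classical_set_scope.
Local Open Scope ring_scope.

Definition convex_body (R : realType) (n : nat) (K : set 'rV[R]_n) : Prop :=
  [/\ compact K, @convex_set R 'rV[R]_n K & interior K !=set0].

Definition homothet (R : realType) (n : nat) (lam : R) (v : 'rV[R]_n)
    (K : set 'rV[R]_n) : set 'rV[R]_n :=
  [set lam *: x + v | x in K].

(* An intersection over the empty family is [setT], so that
   [ball_hull C set0 = setT], as the convention for the empty set requires. *)
Definition ball_hull (R : realType) (n : nat) (C X : set 'rV[R]_n) :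
    set 'rV[R]_n :=
  \bigcap_(v in X) [set x + v | x in C].

Definition diam_complete (R : realType) (n : nat) (C : set 'rV[R]_n) :
    set (set 'rV[R]_n) :=
  [set K | K = ball_hull C K].

Definition wide_ball_hulls (R : realType) (n : nat) (C : set 'rV[R]_n) :
    set (set 'rV[R]_n) :=
  [set K | exists X : set 'rV[R]_n,
     [/\ X !=set0, X `<=` ball_hull C X & K = ball_hull C X]].

Definition covered_by_homothets (R : realType) (n : nat) (K : set 'rV[R]_n)
    (m : nat) : Prop :=
  exists (lam : 'I_m -> R) (v : 'I_m -> 'rV[R]_n),
    (forall i, 0 < lam i < 1) /\
    K `<=` \bigcup_(i in [set: 'I_m]) homothet (lam i) (v i) K.

(* The least and greatest elements of a set of naturals; the value is 0 when
   there is none. *)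
Definition nat_min (A : set nat) : nat := xget 0%N (A `&` lbound A).
Definition nat_max (A : set nat) : nat := xget 0%N (A `&` ubound A).

(* Every convex body has a finite cover by smaller homothets, so the default
   value of [nat_min] is not reached on convex bodies. *)
Definition covering_number (R : realType) (n : nat) (K : set 'rV[R]_n) : nat :=
  nat_min [set m | covered_by_homothets K m].

(* If the covering numbers in F have no maximum then the value is 0, which is
   smaller than the covering number of any convex body; an inequality
   [covering_number K <= family_covering_number F] for a convex body K thus
   includes the existence of the maximum. *)
Definition family_covering_number (R : realType) (n : nat)
    (F : set (set 'rV[R]_n)) : nat :=
  nat_max [set covering_number K | K in F].

(* The infimum is taken in the extended reals, where the infimum of the empty
   set is +oo; the matrices act on row vectors from the right. *)
Definition banach_mazur (R : realType) (n : nat) (K L : set 'rV[R]_n) : \bar R :=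
  ereal_inf [set lam%:E | lam in [set lam : R | 0 < lam /\
    exists (A : 'M[R]_n) (b v : 'rV[R]_n),
      [/\ A \in unitmx,
          K `<=` [set x *m A + b | x in L] &
          [set x *m A + b | x in L] `<=` homothet lam v K]]].

(* Main.v *)
(* Translate the set X generating a member L = B(X) of either family so that
   0 \in X; then X - X `<=` C confines X to the compact set C. Along an
   ultrafilter a sequence of such sets X_k therefore has a Hausdorff limit Y with
   Y - Y `<=` C. Some k satisfies k - Y `<=` (1 - t) C with t > 0, and this
   margin turns Hausdorff closeness of X_k to Y into inclusions of B(X_k) and
   B(Y) in (1 + e)-homothets of each other. If the X_k = B(X_k) are complete,
   then B(Y) - B(Y) `<=` (1 + e) C for all e > 0, so B(Y) is complete. A cover
   of B(Y) by m smaller homothets then transfers to every body at Banach-Mazur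
   distance < 1 + e from B(X_k), for suitable e. Hence covering numbers are
   bounded on the family, and a sequence of bodies contradicting the theorem for delta = 1 + 1/(k + 1)
   cannot exist. *)
Require Import Defs.
From HB Require Import structures.
From mathcomp Require Import all_boot all_order all_algebra finmap.
From mathcomp Require Import all_classical all_reals all_analysis.
From mathcomp Require Import ring lra.

Set Implicit Arguments.
Unset Strict Implicit.
Unset Printing Implicit Defensive.

Import Order.TTheory GRing.Theory Num.Theory.
Import numFieldNormedType.Exports.

Local Open Scope classical_set_scope.
Local Open Scope ring_scope.

(** * Scaled copies of [C] and depth in ball hulls *)

Section BallHulls.
Variables (R : realType) (n : nat).
Implicit Types (C K L X Y : set 'rV[R]_n) (x y z v w c k : 'rV[R]_n).

Definition scale (a : R) C : set 'rV[R]_n := [set a *: c | c in C].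

Lemma scale1E C : scale 1 C = C.
Proof.
apply/seteqP; split=> [_ [c Cc <-]|c Cc]; first by rewrite scale1r.
by exists c; rewrite ?scale1r.
Qed.

Lemma scaleM C (a b : R) x : scale a C x -> scale (b * a) C (b *: x).
Proof. by move=> [c Cc <-]; exists c => //; rewrite scalerA. Qed.

Lemma scaleD C (a b : R) x y : convex_set C -> 0 <= a -> 0 <= b ->
  scale a C x -> scale b C y -> scale (a + b) C (x + y).
Proof.
move=> Ccvx a0 b0 [c Cc <-] [d Cd <-].
have [ab0|ab0] := eqVneq (a + b) 0.
  have [a00 b00] : a = 0 /\ b = 0 by split; lra.
  by exists c; rewrite // a00 b00 addr0 !scale0r addr0.
have abgt0 : 0 < a + b by rewrite lt_neqAle eq_sym ab0 addr_ge0.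
have q0 : 0 <= a / (a + b) by rewrite divr_ge0 // ltW.
have q1 : a / (a + b) <= 1 by rewrite ler_pdivrMr // mul1r lerDl.
(* [convex_set] takes its weight from an interval type, so [a / (a + b)] is packaged first. *)
have itva : Itv.spec (@Itv.num_sem R) (Itv.Real `[0%Z, 1%Z]) (a / (a + b)).
  by rewrite /= /Itv.num_sem /= num_real /= in_itv /= q0 q1.
have := Ccvx c d (Itv.mk itva).
rewrite !inE => /(_ Cc Cd) Ccd.
exists (a / (a + b) *: c + (1 - a / (a + b)) *: d); first exact: Ccd.
rewrite scalerDr !scalerA /unstable.onem; congr (_ *: _ + _ *: _); field.
  by [].
by [].
Qed.

Lemma scale_sum C (I : Type) (s : seq I) (a : I -> R) (f : I -> 'rV[R]_n) :
  convex_set C -> C !=set0 -> (forall i, 0 <= a i) ->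
  (forall i, scale (a i) C (f i)) ->
  scale (\sum_(i <- s) a i) C (\sum_(i <- s) f i).
Proof.
move=> Ccvx [c Cc] a0 Cf; elim: s => [|i s IHs].
  by rewrite !big_nil; exists c; rewrite ?scale0r.
by rewrite !big_cons; apply: scaleD => //; apply: sumr_ge0.
Qed.

Lemma ball_hullE C X y : ball_hull C X y <-> forall x, X x -> C (y - x).
Proof.
split=> [BXy x Xx|CXy x Xx]; last by exists (y - x); rewrite ?subrK //; exact: CXy.
by have [c Cc <-] := BXy x Xx; rewrite addrK.
Qed.

Lemma homothetE (a : R) v K y : a != 0 ->
  homothet a v K y <-> K (a^-1 *: (y - v)).
Proof.
move=> a0; split=> [[x Kx <-]|Ky].
  by rewrite addrK scalerA mulVf // scale1r.
by exists (a^-1 *: (y - v)); rewrite // scalerA divff // scale1r subrK.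
Qed.

(* If [C] is convex, then [k + t C] lies in the ball hull of [X]. *)
Definition depth C X (t : R) k := forall x, X x -> scale (1 - t) C (k - x).

Lemma mem_scale_ball C (c0 : 'rV[R]_n) (r a : R) w : 0 < r -> 0 < a ->
  (forall w, `|w| <= r -> C (c0 + w)) -> `|w| <= a * r ->
  scale a C (a *: c0 + w).
Proof.
move=> r0 a0 Cr wa; exists (c0 + a^-1 *: w).
  apply: Cr; rewrite normrZ gtr0_norm ?invr_gt0 //.
  by rewrite mulrC ler_pdivrMr // mulrC.
by rewrite scalerDr scalerA divff ?gt_eqF // scale1r.
Qed.

(** The margin [t] at [k] pays for the error [s]: up to a shift, [z - x] lies in [(1 + s) C], while
    [k - x] lies in [(1 - t) C]. The weights [t / (s + t)] and [s / (s + t)] bring the total factor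
    to 1. *)
Lemma ball_hull_homothet C X Y (c0 k : 'rV[R]_n) (r t s : R) : convex_set C ->
  0 < r -> 0 < t <= 1 -> 0 < s ->
  (forall w, `|w| <= r -> C (c0 + w)) ->
  depth C X t k ->
  (forall x, X x -> exists2 y, Y y & `|y - x| <= s * r) ->
  exists v, ball_hull C Y `<=` homothet (1 + s / t) v (ball_hull C X).
Proof.
move=> Ccvx r0 /andP[t0 t1] s0 Cr Xk XY.
exists (- (s / t) *: k - s *: c0) => z /ball_hullE CYz.
have st0 : 0 < s + t by lra.
have a0 : 1 + s / t != 0 by rewrite gt_eqF // addr_gt0 // divr_gt0.
apply/homothetE => //; apply/ball_hullE => x Xx.
have [y Yy xys] := XY x Xx.
rewrite -[C]scale1E.
have -> : (1 + s / t)^-1 *: (z - (- (s / t) *: k - s *: c0)) - x =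
  (t / (s + t)) *: ((z - y) + (s *: c0 + (y - x))) + (s / (s + t)) *: (k - x).
  have -> : (1 + s / t)^-1 = t / (s + t).
    by field; rewrite !gt_eqF.
  apply/rowP => i; rewrite !mxE; by field; rewrite !gt_eqF.
have -> : 1 = (t / (s + t)) * (1 + s) + (s / (s + t)) * (1 - t).
  by field; rewrite gt_eqF.
apply: scaleD => //.
- by rewrite mulr_ge0 ?divr_ge0 //; lra.
- by rewrite mulr_ge0 ?divr_ge0 //; lra.
- apply: scaleM; apply: scaleD => //; first exact: ltW.
    by rewrite scale1E; exact: CYz.
  exact: (mem_scale_ball r0 s0 Cr xys).
- by apply: scaleM; exact: Xk.
Qed.

(** Moving [x] by at most [s * r] costs a summand [s C], so the margin drops by [s]. *)
Lemma depth_near C X Y (c0 k : 'rV[R]_n) (r t s : R) : convex_set C ->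
  0 < r -> 0 < s < t -> t <= 1 ->
  (forall w, `|w| <= r -> C (c0 + w)) ->
  depth C X t k ->
  (forall y, Y y -> exists2 x, X x & `|x - y| <= s * r) ->
  depth C Y (t - s) (k + s *: c0).
Proof.
move=> Ccvx r0 /andP[s0 st] t1 Cr Xk YX y Yy.
have [x Xx xys] := YX y Yy.
have -> : 1 - (t - s) = (1 - t) + s by lra.
have -> : k + s *: c0 - y = (k - x) + (s *: c0 + (x - y)).
  by apply/rowP => i; rewrite !mxE; ring.
apply: scaleD => //; [lra|lra|exact: Xk|exact: (mem_scale_ball r0 s0 Cr xys)].
Qed.

End BallHulls.

(** * Existence of a point of positive depth *)

Section Depth.
Variables (R : realType) (n : nat).
Implicit Types (C K L X Y : set 'rV[R]_n) (x y z v w c k : 'rV[R]_n).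

(** Coordinates are linear forms; summing the bounds over all [i] makes [N] uniform. *)
Lemma coord_bounded m (b : m.-tuple 'rV[R]_n) (M : R) : 0 <= M ->
  exists2 N : R, 0 <= N &
    forall x i, `|x| <= M -> `|coord b i x| <= N.
Proof.
move=> M0.
exists (\sum_i \sum_(j < n) M * `|coord b i (delta_mx 0 j)|).
  by apply: sumr_ge0 => i _; apply: sumr_ge0 => j _; rewrite mulr_ge0.
move=> x i xM; rewrite (bigD1 i) //= -[leLHS]addr0; apply: lerD; last first.
  by apply: sumr_ge0 => i' _; apply: sumr_ge0 => j _; rewrite mulr_ge0.
rewrite {1}(row_sum_delta x) linear_sum /=.
apply: le_trans (ler_norm_sum _ _ _) _; apply: ler_sum => j _.
rewrite linearZ /= normrM ler_wpM2r //; apply: le_trans xM.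
by rewrite [leRHS]mx_normrE (le_bigmax _ (fun ij => `|x ij.1 ij.2|) (0, j)).
Qed.

(** A free family has at most [n] members, so a longest one in [X] exists; a vector of [X] outside
    its span would lengthen it. *)
Lemma max_free_family X : exists m (b : m.-tuple 'rV[R]_n),
  [/\ free b, forall i, X (tnth b i) & forall x, X x -> x \in <<b>>%VS].
Proof.
pose P m := `[< exists b : m.-tuple 'rV[R]_n, free b /\ forall i, X (tnth b i) >].
have P0 : exists m, P m.
  exists 0%N; apply/asboolP; exists [tuple]; split; first by rewrite nil_free.
  by case.
have Pn m : P m -> (m <= n)%N.
  move=> /asboolP[b [bfree _]]; move: bfree; rewrite /free => /eqP.
  rewrite size_tuple => <-; apply: leq_trans (dimvS (subvf _)) _.
  by rewrite dimvf /dim /= mul1n.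
case: (ex_maxnP P0 Pn) => m /asboolP[b [bfree Xb]] mmax.
exists m, b; split=> // x Xx; apply: contraT => xb.
suff : P m.+1 by move=> /mmax; rewrite ltnn.
apply/asboolP; exists [tuple of x :: b]; split; first by rewrite free_cons xb.
by move=> i; case: (unliftP ord0 i) => [j|] ->; rewrite ?tnthS ?tnth0.
Qed.

(* The average [k] of [0] and a basis of [X] chosen inside [X] is a relative
   interior point of the convex hull of [X]: for small [e > 0], the point
   [y = k + e (k - x)] is a convex combination of points of [X], and then
   [k - x = (1 + e)^-1 (y - x)]. *)
Lemma depth_exists C X : convex_set C -> X 0 ->
  (forall x y, X x -> X y -> C (x - y)) ->
  (exists M : R, forall x, X x -> `|x| <= M) ->
  exists (t : R) k, 0 < t <= 1 /\ depth C X t k.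
Proof.
move=> Ccvx X0 XX [M XM].
have M0 : 0 <= M by apply: le_trans (XM 0 X0).
have [m [b [_ Xb bX]]] := max_free_family X.
have [N N0 bN] := coord_bounded b M0.
pose q : R := m.+1%:R.
have q0 : 0 < q by rewrite ltr0n.
have mq : m%:R = q - 1 :> R by rewrite /q -natr1; lra.
have q1 : 1 <= q by rewrite ler1n.
(* Small enough that the weights [c i] below are nonnegative with sum at most 1; the remaining
   weight goes to the point 0. *)
pose e := (q ^+ 2 * (N + 1))^-1.
have e_def : e * (q ^+ 2 * (N + 1)) = 1.
  by rewrite mulVf // gt_eqF // mulr_gt0 ?exprn_gt0 //; lra.
have e0 : 0 < e by rewrite invr_gt0 mulr_gt0 ?exprn_gt0 //; lra.
exists (e / (1 + e)), (\sum_(i < m) q^-1 *: tnth b i); split.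
  by rewrite divr_gt0 ?ler_pdivrMr /=; lra.
move=> x Xx; set k := \sum_(i < m) _.
pose a i := coord b i x.
have xE : x = \sum_(i < m) a i *: tnth b i.
  by rewrite {1}(coord_span (bX _ Xx)); apply: eq_bigr => i _; rewrite (tnth_nth 0).
pose c i := (1 + e) / q - e * a i.
have aN i : `|a i| <= N by apply: bN; exact: XM.
have eqN : e * N <= q^-1.
  rewrite -[leRHS]mul1r ler_pdivlMr // -e_def -mulrA ler_pM2l //; nra.
have c0 i : 0 <= c i.
  rewrite /c subr_ge0; have := ler_norm (a i) => an.
  apply: le_trans (_ : e * N <= _); first by rewrite ler_pM2l // (le_trans an).
  by apply: le_trans eqN _; rewrite ler_peMl ?invr_ge0; lra.
have cs : \sum_(i < m) c i <= 1.
  rewrite big_split /= sumr_const card_ord -mulr_natl mq.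
  have : \sum_(i < m) - (e * a i) <= \sum_(i < m) e * N.
    apply: ler_sum => i _; rewrite -mulrN ler_pM2l // (le_trans _ (aN i)) //.
    by rewrite ler_normr lexx orbT.
  rewrite [leRHS]sumr_const card_ord -mulr_natl mq => sN.
  apply: le_trans (lerD (lexx _) sN) _.
  have -> : (q - 1) * ((1 + e) / q) + (q - 1) * (e * N) =
      (q - 1 + e * ((q - 1) * (1 + q * N))) / q.
    by field; rewrite gt_eqF.
  have qN0 : 0 <= q * N by rewrite mulr_ge0 // ltW.
  have : e * ((q - 1) * (1 + q * N)) <= 1 by rewrite -e_def ler_pM2l //; nra.
  by rewrite ler_pdivrMr // mul1r; lra.
have kx : k - x = (1 + e)^-1 *:
    (\sum_(i < m) c i *: (tnth b i - x) + (1 - \sum_(i < m) c i) *: (0 - x)).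
  have cb : \sum_(i < m) c i *: tnth b i = (1 + e) *: k - e *: x.
    rewrite [in RHS]xE !scaler_sumr -sumrB; apply: eq_bigr => i _.
    by rewrite scalerBl !scalerA.
  under eq_bigr do rewrite scalerBr.
  rewrite sumrB cb -scaler_suml.
  apply/rowP => i; rewrite !mxE; field; rewrite gt_eqF //; lra.
rewrite kx.
have -> : 1 - e / (1 + e) = (1 + e)^-1 * 1 by field; rewrite gt_eqF //; lra.
apply: scaleM; rewrite -[X in scale X](subrKC (\sum_(i < m) c i)).
apply: scaleD => //.
- exact: sumr_ge0.
- by rewrite subr_ge0.
- apply: scale_sum => //; first by exists (0 - 0); exact: XX.
  by move=> i; exists (tnth b i - x) => //; exact: XX.
- by exists (0 - x) => //; exact: XX.
Qed.
End Depth.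

(** * Hausdorff limits along an ultrafilter *)

Section UltraLimits.
Variables (R : realType) (n : nat) (T : Type) (U : set_system T).
Hypothesis Uultra : UltraFilter U.
Implicit Types (C : set 'rV[R]_n) (X : T -> set 'rV[R]_n).

(** Compactness gives a cluster point, and an ultrafilter decides every ball, so a cluster point is
    a limit. *)
Lemma ultra_cvg C (z : T -> 'rV[R]_n) : compact C ->
  (\forall k \near U, C (z k)) ->
  exists2 x, C x & forall e, 0 < e -> \forall k \near U, `|x - z k| < e.
Proof.
move=> Cco Cz; have [x [Cx clx]] := Cco (z @ U) _ Cz.
exists x => // e e0.
have [//|nB] := in_ultra_setVsetC [set k | `|x - z k| < e] Uultra.
have xB : nbhs x (ball x e) by exact: nbhsx_ballx.
have zB : (z @ U) (~` ball x e).
  rewrite -ball_normE; exact: nB.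
by have [y []] := clx _ _ zB xB.
Qed.

(** The lower Kuratowski limit along [U]. If [C] is compact and contains every [X k], the next two
    lemmas make it the Hausdorff limit. *)
Definition ultra_limit C X : set 'rV[R]_n :=
  [set x | C x /\
    forall e, 0 < e -> \forall k \near U, exists2 z, X k z & `|x - z| <= e].

(** Otherwise bad points [z k] converge to some [x]. A fixed [z k0] near [x] is approximated by most
    [X k], hence so is some bad [z k]. *)
Lemma ultra_limit_near C X (e : R) : compact C -> 0 < e ->
  \forall k \near U, forall x, ultra_limit C X x ->
    exists2 z, X k z & `|x - z| <= e.
Proof.
move=> Cco e0; set A := fun k => forall x, _.
have [//|nA] := in_ultra_setVsetC [set k | A k] Uultra; exfalso.
have [z zP] : {z : T -> 'rV[R]_n & forall k, ~ A k ->
    ultra_limit C X (z k) /\ ~ exists2 w, X k w & `|z k - w| <= e}.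
  apply: (@choice _ _ (fun k x => ~ A k -> ultra_limit C X x /\
    ~ exists2 w, X k w & `|x - w| <= e)) => k.
  have [Ak|nAk] := pselect (A k); first by exists 0.
  by move: (nAk) => /existsNP[x /not_implyP]; exists x.
have [|x Cx xz] := ultra_cvg (z := z) Cco.
  by apply: filterS nA => k /zP[[]].
have e40 : 0 < e / 4 by lra.
have [k0 [nAk0 xzk0]] := filter_ex (filterI nA (xz _ e40)).
have [[_ /(_ _ e40) Xzk0] _] := zP _ nAk0.
have [k [[nAk xzk] [w Xw zw]]] := filter_ex (filterI (filterI nA (xz _ e40)) Xzk0).
have [_] := zP _ nAk; apply; exists w => //.
have -> : z k - w = (x - z k0) - (x - z k) + (z k0 - w).
  by apply/rowP => i; rewrite !mxE; ring.
have h1 := ler_normD (x - z k0 - (x - z k)) (z k0 - w).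
have h2 := ler_normB (x - z k0) (x - z k).
move: xzk0 xzk => /= h3 h4.
lra.
Qed.

(** Otherwise bad points [z k] of [X k] converge to some [x], and they witness themselves that [x]
    is in the limit. *)
Lemma near_ultra_limit C X (e : R) : compact C -> (forall k, X k `<=` C) ->
  0 < e ->
  \forall k \near U, forall z, X k z ->
    exists2 x, ultra_limit C X x & `|x - z| <= e.
Proof.
move=> Cco XC e0; set A := fun k => forall x, _.
have [//|nA] := in_ultra_setVsetC [set k | A k] Uultra; exfalso.
have [z zP] : {z : T -> 'rV[R]_n & forall k, ~ A k ->
    X k (z k) /\ ~ exists2 x, ultra_limit C X x & `|x - z k| <= e}.
  apply: (@choice _ _ (fun k z => ~ A k -> X k z /\
    ~ exists2 x, ultra_limit C X x & `|x - z| <= e)) => k.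
  have [Ak|nAk] := pselect (A k); first by exists 0.
  by move: (nAk) => /existsNP[x /not_implyP]; exists x.
have [|x Cx xz] := ultra_cvg (z := z) Cco.
  by apply: filterS nA => k /zP[+ _]; exact: XC.
have [k [nAk xzk]] := filter_ex (filterI nA (xz _ e0)).
have [_] := zP _ nAk; apply; exists x; last exact: ltW.
split=> // d d0; apply: filterS (filterI nA (xz _ d0)) => k' [/zP[Xz _] /ltW].
by exists (z k').
Qed.

Lemma ultra_limit_sub C X : closed C -> (forall k x y, X k x -> X k y -> C (x - y)) ->
  forall x y, ultra_limit C X x -> ultra_limit C X y -> C (x - y).
Proof.
move=> Ccl XC x y [_ Xx] [_ Xy]; apply: contrapT => nCxy.
have : nbhs (x - y) (~` C) by apply: open_nbhs_nbhs; split=> //; exact: closed_openC.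
move=> /nbhs_ballP[e /= e0 eC].
have e40 : 0 < e / 4 by lra.
have [k [[x' Xx' xx'] [y' Xy' yy']]] := filter_ex (filterI (Xx _ e40) (Xy _ e40)).
apply: (eC (x' - y')); last exact: XC Xx' Xy'.
rewrite -ball_normE /=.
have -> : x - y - (x' - y') = (x - x') - (y - y').
  by apply/rowP => i; rewrite !mxE; ring.
have h1 := ler_normB (x - x') (y - y').
lra.
Qed.

End UltraLimits.

(** * Limits of ball hulls *)

Lemma affine_continuous (R : realType) (V : normedModType R) (a : R) (u w : V) :
  continuous (fun y => a *: (y - u) + w).
Proof.
move=> y; apply: cvgD; last exact: cvg_cst.
by apply: cvgZl_tmp; apply: cvgB; [exact: cvg_id|exact: cvg_cst].
Qed.

Section Families.
Variables (R : realType) (n : nat).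
Implicit Types (C K L X Y : set 'rV[R]_n) (x y z v w c : 'rV[R]_n).

Lemma convex_body_ball C : convex_body C ->
  exists (c0 : 'rV[R]_n) (r : R), 0 < r /\ forall w, `|w| <= r -> C (c0 + w).
Proof.
move=> [_ _ [c0 /nbhs_ballP[e /= e0 eC]]]; exists c0, (e / 2); split; first by lra.
move=> w we; apply: eC; rewrite -ball_normE /= opprD addrA subrr add0r normrN.
by lra.
Qed.

Lemma compact_norm_bounded C : compact C ->
  exists M : R, 0 < M /\ forall x, C x -> `|x| <= M.
Proof.
move=> /compact_bounded[M [_ MC]]; exists (`|M| + 1).
by have := normr_ge0 M; split; [lra|apply: MC; have := ler_norm M; lra].
Qed.

(** At each point of [K] a half-size copy of the interior is placed, with [p] moved to that point;
    finitely many of these open sets cover [K]. *)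
Lemma compact_homothet_cover K : compact K -> interior K !=set0 ->
  exists m, covered_by_homothets K m.
Proof.
move=> Kco [p Kp].
pose f x : set 'rV[R]_n := [set y | K° (2 *: (y - x) + p)].
have : cover_compact K by rewrite -compact_cover.
move=> /(_ _ K f)[].
- move=> x Kx; rewrite /f.
  apply: (open_comp (f := fun y => 2 *: (y - x) + p)); last exact: open_interior.
  by move=> y _; exact: affine_continuous.
- by move=> x Kx; exists x => //; rewrite /f /= subrr scaler0 add0r.
move=> D DK Kf; exists #|` D|, (fun=> 2^-1), (fun i => nth 0 D i - 2^-1 *: p).
split; first by move=> i; lra.
move=> y /Kf[x /= xD fxy].
have iD : (index x D < #|` D|)%N by rewrite index_mem.
exists (Ordinal iD) => //=; rewrite nth_index //.
apply/homothetE; first by rewrite invr_neq0.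
have -> : (2^-1)^-1 *: (y - (x - 2^-1 *: p)) = 2 *: (y - x) + p.
  by apply/rowP => i; rewrite !mxE; field.
exact: interior_subset fxy.
Qed.

Lemma ball_hull_compact C X : compact C -> X 0 -> compact (ball_hull C X).
Proof.
move=> Cco X0; have Ccl : closed C by apply: compact_closed => //; exact: norm_hausdorff.
apply: (subclosed_compact _ Cco); last by move=> y /ball_hullE/(_ _ X0); rewrite subr0.
apply: closed_bigI => x Xx.
rewrite (_ : [set _ | _ in C] = (fun y => y - x) @^-1` C).
  apply: closed_comp => // y _.
  rewrite (_ : (fun _ => _) = fun y => 1 *: (y - x) + 0); first exact: affine_continuous.
  by apply/funext => z; rewrite scale1r addr0.
apply/seteqP; split=> [_ [c Cc <-]|y /= Cyx]; first by rewrite /= addrK.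
by exists (y - x); rewrite ?subrK.
Qed.

Lemma ball_hull_interior C X (t : R) (k : 'rV[R]_n) : convex_body C ->
  0 < t <= 1 -> depth C X t k -> interior (ball_hull C X) !=set0.
Proof.
move=> Cbody /andP[t0 t1] Xk; have [_ Ccvx _] := Cbody.
have [c0 [r [r0 Cr]]] := convex_body_ball Cbody.
exists (k + t *: c0); apply/nbhs_ballP; exists (t * r); first exact: mulr_gt0.
move=> y; rewrite -ball_normE /= => yr; apply/ball_hullE => x Xx.
rewrite -[C]scale1E; have -> : 1 = (1 - t) + t by rewrite subrK.
have -> : y - x = (k - x) + (t *: c0 + (y - (k + t *: c0))).
  by apply/rowP => i; rewrite !mxE; ring.
apply: scaleD => //; [lra|exact: ltW|exact: Xk|].
have yr' : `|y - (k + t *: c0)| <= t * r by rewrite distrC ltW.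
exact: (mem_scale_ball r0 t0 Cr yr').
Qed.

(** Both translations are free, so sets may be translated to contain 0. *)
Definition homothet_close (e : R) K L :=
  (exists v, K `<=` homothet (1 + e) v L) /\
  (exists v, L `<=` homothet (1 + e) v K).

(** The depth of the ultralimit [Y] gives its hull an interior, hence a finite cover, and one of the
    two inclusions; the depth inherited by nearby [X k] gives the other. *)
Lemma ball_hull_ultra_limit (T : Type) (U : set_system T) C
    (X : T -> set 'rV[R]_n) :
  UltraFilter U -> convex_body C -> (forall k, X k 0) ->
  (forall k x y, X k x -> X k y -> C (x - y)) ->
  exists Y, [/\ Y 0, forall x y, Y x -> Y y -> C (x - y),
    exists m, covered_by_homothets (ball_hull C Y) m &
    forall e, 0 < e -> \forall k \near U,
      homothet_close e (ball_hull C (X k)) (ball_hull C Y)].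
Proof.
move=> Uultra Cbody X0 XX; have [Cco Ccvx _] := Cbody.
have Ccl : closed C by apply: compact_closed => //; exact: norm_hausdorff.
have XC k : X k `<=` C by move=> x Xx; rewrite -[x]subr0; exact: XX Xx (X0 k).
have [c0 [r [r0 Cr]]] := convex_body_ball Cbody.
have [M [M0 CM]] := compact_norm_bounded Cco.
set Y := ultra_limit U C X.
have Y0 : Y 0.
  have [k _] := filter_ex (filterT : U setT).
  split; first exact: XC (X0 k).
  by move=> e e0; apply: nearW => j; exists 0 => //; rewrite subr0 normr0 ltW.
have YY x y : Y x -> Y y -> C (x - y) by apply: (ultra_limit_sub Uultra Ccl XX).
have [t [k [t01 Yk]]] : exists (t : R) k, 0 < t <= 1 /\ depth C Y t k.
  by apply: depth_exists => //; exists M => x [/CM].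
have /andP[t0 t1] := t01.
exists Y; split=> //.
  apply: compact_homothet_cover; first exact: ball_hull_compact.
  exact: ball_hull_interior t01 Yk.
move=> e e0.
(* Chosen so that [s / t = e] and [s' / (t - s') = e], where [t - s'] is the depth left for
   [X j]. *)
pose s := e * t; pose s' := (e / (1 + e)) * t.
have s0 : 0 < s by apply: mulr_gt0.
have s'0 : 0 < s' by rewrite mulr_gt0 // divr_gt0; lra.
have s't : s' < t by rewrite gtr_pMl // ltr_pdivrMr; lra.
have sr := mulr_gt0 s0 r0; have s'r := mulr_gt0 s'0 r0.
have nYX := ultra_limit_near Uultra X Cco.
have nXY := near_ultra_limit Uultra Cco XC s'r.
apply: filterS (filterI (filterI (nYX _ sr) (nYX _ s'r)) nXY).
move=> j [[YXs YXs'] XYs']; split.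
  have -> : 1 + e = 1 + s / t by rewrite /s mulfK // gt_eqF.
  apply: (ball_hull_homothet Ccvx r0 t01 s0 Cr Yk) => x /YXs[y Xy xy].
  by exists y; rewrite // distrC.
have -> : 1 + e = 1 + s' / (t - s').
  have -> : t - s' = t / (1 + e) by rewrite /s'; field; rewrite gt_eqF //; lra.
  by rewrite /s'; field; rewrite !gt_eqF //; lra.
apply: (ball_hull_homothet Ccvx r0 _ s'0 Cr
  (depth_near Ccvx r0 _ t1 Cr Yk XYs')) => [| |x /XYs'[y Yy xy]]; [lra|lra|].
by exists y.
Qed.

End Families.

(** * Extremal elements of sets of naturals *)

Lemma nat_minP (A : set nat) m : A m -> A (nat_min A) /\ (nat_min A <= m)%N.
Proof.
move=> Am; rewrite /nat_min; case: xgetP => [k _ [Ak kA]|noA].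
  by split=> //; have := kA _ Am; rewrite leEnat.
have [k /asboolP Ak kmin] := ex_minnP (ex_intro (fun k => `[< A k >]) m (asboolT Am)).
case: (noA k); split=> // j Aj; rewrite leEnat; apply: kmin; exact/asboolP.
Qed.

(** The bound [N] ensures that a maximum exists, so the default 0 is not taken. *)
Lemma le_nat_max (A : set nat) m N :
  A m -> (forall k, A k -> k <= N)%N -> (m <= nat_max A)%N.
Proof.
move=> Am AN; rewrite /nat_max; case: xgetP => [k _ [_ /(_ _ Am)]|noA].
  by rewrite leEnat.
have AN' i : `[< A i >] -> (i <= N)%N by move=> /asboolP /AN.
have [k /asboolP Ak kmax] := ex_maxnP (ex_intro (fun k => `[< A k >]) m (asboolT Am)) AN'.
case: (noA k); split=> // j Aj; rewrite leEnat; apply: kmax; exact/asboolP.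
Qed.

(** * Both families are closed under limits *)

Section CoveringNumbers.
Variables (R : realType) (n : nat).
Implicit Types (C K L X : set 'rV[R]_n) (F : set (set 'rV[R]_n)).

Lemma ball_hull_shift C X (a : 'rV[R]_n) :
  ball_hull C [set x - a | x in X] = [set y - a | y in ball_hull C X].
Proof.
apply/seteqP; split=> [y /ball_hullE yX|_ [y /ball_hullE yX <-]].
  exists (y + a); rewrite ?addrK //; apply/ball_hullE => x Xx.
  have := yX (x - a) (ex_intro2 _ _ x Xx erefl).
  by congr C; rewrite opprB addrA.
apply/ball_hullE => _ [x Xx <-]; have := yX x Xx.
by congr C; rewrite opprB addrA subrK.
Qed.

Lemma homothet_close_shift (e : R) (a : 'rV[R]_n) K L :
  homothet_close e [set y - a | y in K] L -> homothet_close e K L.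
Proof.
move=> [[v Kv] [w Lw]]; split.
  exists (v + a) => y Ky; have [|z Lz zy] := Kv (y - a); first by exists y.
  by exists z => //; rewrite addrA zy subrK.
exists (w - (1 + e) *: a) => y /Lw[_ [z Kz <-] <-]; exists z => //.
by rewrite scalerBr addrAC addrA.
Qed.

(** Compactness of [F] up to translation. The finite cover makes the covering number of the limit a
    true minimum. *)
Definition limit_closed F := forall (T : Type) (U : set_system T)
  (L : T -> set 'rV[R]_n), UltraFilter U -> (forall k, F (L k)) ->
  exists K, [/\ F K, exists m, covered_by_homothets K m &
    forall e, 0 < e -> \forall k \near U, homothet_close e (L k) K].

(** Inclusion of [X] in its ball hull means that [X - X] lies in [C]; this is translation invariant
    and passes to the limit [Y]. *)
Lemma wide_ball_hulls_limit_closed C :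
  convex_body C -> limit_closed (wide_ball_hulls C).
Proof.
move=> Cbody T U L Uultra CL.
have /choice[X XP] := CL.
have /choice[a aX] : forall k, exists a, X k a.
  by move=> k; have [[a] ] := XP k; exists a.
pose X' k := [set x - a k | x in X k].
have X'0 k : X' k 0 by exists (a k); rewrite ?subrr.
have X'X' k x y : X' k x -> X' k y -> C (x - y).
  move=> [{}x Xx <-] [{}y Xy <-]; have [_ XB _] := XP k.
  by move: (XB _ Xx) => /ball_hullE/(_ _ Xy); rewrite opprB addrA subrK.
have [Y [Y0 YY cov YX]] := ball_hull_ultra_limit Uultra Cbody X'0 X'X'.
exists (ball_hull C Y); split=> //.
  exists Y; split=> //; first by exists 0.
  by move=> x Yx; apply/ball_hullE => y Yy; exact: YY.
move=> e /YX; apply: filterS => k; have [_ _ ->] := XP k.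
by rewrite ball_hull_shift; exact: homothet_close_shift.
Qed.

(** If [w = (1 + e) c], then [w] is within [e * M] of [c], and [C] is closed. *)
Lemma compact_scale_closed C (w : 'rV[R]_n) : compact C ->
  (forall e, 0 < e -> scale (1 + e) C w) -> C w.
Proof.
move=> Cco Cw; have Ccl : closed C by apply: compact_closed => //; exact: norm_hausdorff.
have [M [M0 CM]] := compact_norm_bounded Cco.
apply: contrapT => nCw.
have : nbhs w (~` C) by apply: open_nbhs_nbhs; split=> //; exact: closed_openC.
move=> /nbhs_ballP[d /= d0 dC].
have e0 : 0 < d / (2 * M) by rewrite divr_gt0 // mulr_gt0.
have [c Cc cw] := Cw _ e0.
apply: (dC c) => //; rewrite -ball_normE /= -cw scalerDl scale1r addrAC subrr add0r.
rewrite normrZ gtr0_norm //.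
apply: le_lt_trans (_ : d / (2 * M) * M < d); first by rewrite ler_pM2l // CM.
by have -> : d / (2 * M) * M = d / 2; [field; rewrite gt_eqF|lra].
Qed.

Lemma ball_hull_sub C X Y : X `<=` Y -> ball_hull C Y `<=` ball_hull C X.
Proof. by move=> XY y /ball_hullE yY; apply/ball_hullE => x /XY/yY. Qed.

(** A complete body generates itself. Differences in the limit are [1 + e] times differences in some
    [L k], so they lie in [(1 + e) C] for every [e > 0], hence in [C]. *)
Lemma diam_complete_limit_closed C :
  convex_body C -> limit_closed (diam_complete C).
Proof.
move=> Cbody T U L Uultra CL; have [Cco Ccvx _] := Cbody.
have /choice[a aX] : forall k, exists a, L k a.
  move=> k; apply: contrapT => nL.
  (* An empty member would equal [ball_hull C set0], the whole space. *)
  have L0 : L k = set0 by apply/seteqP; split=> // x Lx; case: nL; exists x.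
  suff : L k 0 by rewrite L0.
  by rewrite (CL k) L0; apply/ball_hullE.
pose X' k := [set x - a k | x in L k].
have X'0 k : X' k 0 by exists (a k); rewrite ?subrr.
have X'E k : ball_hull C (X' k) = X' k by rewrite ball_hull_shift -(CL k).
have X'X' k x y : X' k x -> X' k y -> C (x - y).
  by rewrite -{1}X'E => /ball_hullE; apply.
have [Y [Y0 YY cov YX]] := ball_hull_ultra_limit Uultra Cbody X'0 X'X'.
exists (ball_hull C Y); split=> //; last first.
  move=> e /YX; apply: filterS => k.
  by rewrite X'E; exact: homothet_close_shift.
apply/seteqP; split; last first.
  by apply: ball_hull_sub => x Yx; apply/ball_hullE => y Yy; exact: YY.
move=> y By; apply/ball_hullE => x Bx; apply: compact_scale_closed => // e /YX YXe.
have [k [_ [v Yv]]] := filter_ex YXe.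
move: Yv; rewrite X'E => Yv.
(* The common translation [v] cancels in the difference. *)
have [y' Xy' <-] := Yv _ By; have [x' Xx' <-] := Yv _ Bx.
exists (y' - x'); first exact: X'X' Xx'.
by rewrite scalerBr; apply/rowP => i; rewrite !mxE; ring.
Qed.

(** * Transfer of covers to nearby bodies *)

Lemma covered_by_homothets_lt1 K m : covered_by_homothets K m ->
  exists (lam : 'I_m -> R) (v : 'I_m -> 'rV[R]_n) (l : R),
    [/\ 0 < l < 1, forall i, 0 < lam i <= l &
    K `<=` \bigcup_(i in [set: 'I_m]) homothet (lam i) (v i) K].
Proof.
(* Starting the maximum at 1/2 keeps [l] positive even for [m = 0]. *)
move=> [lam [v [lam01 KU]]]; exists lam, v, (\big[Num.max/2^-1]_i lam i); split=> //.
  rewrite (lt_le_trans _ (bigmax_ge_id _ _ _ _)) ?invr_gt0 //=.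
  by apply: bigmax_lt => [|i _]; [lra|have /andP[] := lam01 i].
by move=> i; have /andP[-> _] := lam01 i; rewrite le_bigmax.
Qed.

(** With [T x = x A + b] and up to translation, [K] lies in [T L'], [L'] in [(1 + e) L], each piece
    [mu i L] of the cover in [(1 + e) mu i L'], and [T L'] in [lam K]. The new ratios are
    [(1 + e)^2 mu i lam]. *)
Lemma covered_by_homothets_near L m : covered_by_homothets L m ->
  exists2 e : R, 0 < e & forall K L' (lam : R) (A : 'M[R]_n) (b v : 'rV[R]_n),
    0 < lam < 1 + e -> K `<=` [set x *m A + b | x in L'] ->
    [set x *m A + b | x in L'] `<=` homothet lam v K ->
    homothet_close e L' L -> covered_by_homothets K m.
Proof.
move=> /covered_by_homothets_lt1[mu [u [l [/andP[l0 l1] mul LU]]]].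
(* Then [l = 1 - 8 e] with [0 < e <= 1/8], so [(1 + e)^3 l < 1]. *)
exists ((1 - l) / 8); first lra.
move=> K L' lam A b v; set e := (1 - l) / 8.
have e0 : 0 < e by rewrite /e; lra.
have e18 : e <= 1 / 8 by rewrite /e; lra.
have el : l = 1 - 8 * e by rewrite /e; lra.
move=> /andP[lam0 lame] KL' L'K [[a L'L] [a' LL']].
exists (fun i => (1 + e) ^+ 2 * mu i * lam).
exists (fun i => ((1 + e) ^+ 2 * mu i) *: (v - b) +
  ((1 + e) *: (mu i *: a' + u i) + a) *m A + b).
split=> [i|y /KL'[x L'x <-]].
  have /andP[mu0 mu1] := mul i.
  rewrite !mulr_gt0 ?exprn_gt0 //; [|lra..].
  apply: le_lt_trans (_ : (1 + e) ^+ 2 * l * (1 + e) < 1).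
    apply: ler_pM; [| |by rewrite ler_pM2l // exprn_gt0 //; lra|exact: ltW].
      by rewrite mulr_ge0 ?exprn_ge0 //; lra.
    exact: ltW.
  rewrite el; have := mulr_gt0 e0 e0; nra.
have [z Lz <-] := L'L _ L'x.
have [i _ [t Lt <-]] := LU _ Lz.
have [t' L't' <-] := LL' _ Lt.
have [q Kq qt] := L'K (t' *m A + b) (ex_intro2 _ _ t' L't' erefl).
exists i => //=; exists q => //=.
have {}qt : lam *: q = t' *m A + b - v by rewrite -qt addrK.
rewrite -[_ *: q]scalerA qt !scalerDr !mulmxDl -!scalemxAl.
apply/rowP => j; rewrite !mxE; ring.
Qed.

Lemma covering_number_le K m :
  covered_by_homothets K m -> (covering_number K <= m)%N.
Proof. by move=> /nat_minP[]. Qed.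

Lemma covered_by_covering_number K m : covered_by_homothets K m ->
  covered_by_homothets K (covering_number K).
Proof. by move=> /nat_minP[]. Qed.

Lemma banach_mazur_lt K L (d : R) : (banach_mazur K L < d%:E)%E ->
  exists (lam : R) (A : 'M[R]_n) (b v : 'rV[R]_n), [/\ 0 < lam < d,
    K `<=` [set x *m A + b | x in L] &
    [set x *m A + b | x in L] `<=` homothet lam v K].
Proof.
move=> /ereal_inf_lt[_ [lam [lam0 [A [b [v [_ KL LK]]]]] <-]].
by rewrite lte_fin => lamd; exists lam, A, b, v; rewrite lam0 lamd.
Qed.

Lemma banach_mazur_refl K : (banach_mazur K K <= 1)%E.
Proof.
apply: ereal_inf_lbound; exists 1 => //; split=> //.
exists 1%:M, 0, 0; rewrite unitmx1; split=> // x.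
  by move=> Kx; exists x; rewrite // mulmx1 addr0.
by move=> [y Ky <-]; exists y; rewrite // mulmx1 addr0 scale1r addr0.
Qed.

(** * Stability of covering numbers by passing to limits *)

Lemma covering_number_limit F (K L : nat -> set 'rV[R]_n) :
  limit_closed F -> (forall k, F (L k)) ->
  (forall k, banach_mazur (K k) (L k) < (1 + k.+1%:R^-1)%:E)%E ->
  exists2 L0, F L0 & forall N, exists2 k, (N <= k)%N &
    (covering_number (K k) <= covering_number L0)%N.
Proof.
move=> Fcl FL KL.
(* [U] contains all cofinite sets, so a single [k] can satisfy [N <= k], [1 / (k + 1) < e] and
   closeness of [L k] to [L0]. *)
have [U [Uultra Uoo]] := ultraFilterLemma (@eventually_filter).
have [L0 [FL0 [m /covered_by_covering_number cov] clo]] := Fcl _ _ _ Uultra FL.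
exists L0 => // N.
have [e e0 eP] := covered_by_homothets_near cov.
have Ue : U [set k : nat | k.+1%:R^-1 < e].
  apply: Uoo; exact: (near_infty_natSinv_lt (PosNum e0)).
have UN : U [set k | (N <= k)%N] by apply: Uoo; exact: nbhs_infty_ge.
have [k [[Lk ke] Nk]] := filter_ex (filterI (filterI (clo _ e0) Ue) UN).
exists k => //; apply: covering_number_le.
have [lam [A [b [v [/andP[lam0 lame] KL1 KL2]]]]] := banach_mazur_lt (KL k).
apply: eP KL1 KL2 Lk; rewrite lam0 (lt_trans lame) // ltrD2l.
exact: ke.
Qed.

Lemma limit_closed_stable F : limit_closed F ->
  exists2 delta : R, 1 < delta & forall K,
    (exists2 L, F L & (banach_mazur K L < delta%:E)%E) ->
    (covering_number K <= family_covering_number F)%N.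
Proof.
move=> Fcl.
(* Boundedness secures the maximum over [F]. If covering numbers exceeded every [k], the sequence
   [L], compared with itself at distance at most 1, would have a limit [L0] dominating some [L k]
   with [k >= covering_number L0]. *)
have [N FN] : exists N, forall L, F L -> (covering_number L <= N)%N.
  apply: contrapT => nN.
  have /choice[L LP] : forall k, exists L, F L /\ (k < covering_number L)%N.
    move=> k; apply: contrapT => nL; apply: nN; exists k => L FL.
    by rewrite leqNgt; apply/negP => kL; apply: nL; exists L.
  have [||L0 FL0 /(_ (covering_number L0))[k Nk]] :=
    @covering_number_limit F L L Fcl.
  - by move=> k; have [] := LP k.
  - move=> k; apply: le_lt_trans (banach_mazur_refl _) _.
    by rewrite lte_fin ltrDl invr_gt0.
  - have [_ kL] := LP k.
    by move=> /(leq_trans kL); rewrite ltnNge Nk.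
(* Counterexamples for [1 + 1 / (k + 1)] yield [L0] in [F] whose covering number is at least that of
   some [K k], hence above the maximum over [F]. *)
apply: contrapT => nd.
have /choice[K KP] : forall k : nat, exists K,
    (exists2 L, F L & (banach_mazur K L < (1 + k.+1%:R^-1)%:E)%E) /\
    (family_covering_number F < covering_number K)%N.
  move=> k; apply: contrapT => nK; apply: nd; exists (1 + k.+1%:R^-1).
    by rewrite ltrDl invr_gt0.
  move=> K KF; rewrite leqNgt; apply/negP => lt; apply: nK; exists K; split=> //.
have /choice[L LP] : forall k, exists L,
    F L /\ (banach_mazur (K k) L < (1 + k.+1%:R^-1)%:E)%E.
  by move=> k; have [[L FL KL] _] := KP k; exists L.
have [||L0 FL0 /(_ 0)[k _]] := @covering_number_limit F K L Fcl.
- by move=> k; have [] := LP k.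
- by move=> k; have [] := LP k.
rewrite leqNgt => /negP; apply.
have [_ ] := KP k; apply: leq_ltn_trans.
apply: (@le_nat_max _ _ N); first by exists L0.
by move=> _ [L1 FL1 <-]; exact: FN.
Qed.

End CoveringNumbers.

Theorem theorem11 (R : realType) (n : nat) (n_gt0 : (0 < n)%N)
    (C : set 'rV[R]_n) (C_body : convex_body C) :
  exists2 delta : R, 1 < delta &
    forall K : set 'rV[R]_n, convex_body K ->
      ((exists2 L, diam_complete C L & (banach_mazur K L < delta%:E)%E) ->
         (covering_number K <= family_covering_number (diam_complete C))%N) /\
      ((exists2 L, wide_ball_hulls C L & (banach_mazur K L < delta%:E)%E) ->
         (covering_number K <= family_covering_number (wide_ball_hulls C))%N).
Proof.
have [d1 d1_gt1 d1P] := limit_closed_stable (diam_complete_limit_closed C_body).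
have [d2 d2_gt1 d2P] := limit_closed_stable (wide_ball_hulls_limit_closed C_body).
exists (Num.min d1 d2); first by rewrite lt_min d1_gt1.
move=> K _; split=> -[L FL KL].
  apply: d1P; exists L => //; apply: lt_le_trans KL _.
  by rewrite lee_fin ge_min lexx.
apply: d2P; exists L => //; apply: lt_le_trans KL _.
by rewrite lee_fin ge_min lexx orbT.
Qed.
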